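(* The Moser regularizations for the Kepler problem in $\mathbb{R}^3$ and for the Kepler problem on the upper hemisphere of $S^3$ are related by the gnomonic transformation.
   Context: Notation: $\langle\cdot,\cdot\rangle$ is the Euclidean inner product on $\mathbb{R}^4$; $\cdot$, $\times$, $|\cdot|$ are the dot product, cross product and norm on $\mathbb{R}^3$; $q=(q_0,\boldsymbol q)$, $v=(v_0,\boldsymbol v)\in\mathbb{R}\times\mathbb{R}^3$; $TS^3=\{(q,v):\langle q,q\rangle=1,\ \langle q,v\rangle=0\}$; $\gamma>0$ is a fixed constant; the upper hemisphere is $\{q\in S^3:q_0>0\}$. Kepler problem on $S^3$ (time $t$): $\dot q=v$, $\dot v=\frac{\gamma e_0}{(1-q_0^2)^{3/2}}-\big(\langle v,v\rangle+\gamma\frac{q_0}{(1-q_0^2)^{3/2}}\big)q$ on $TS^3$, with $e_0=(1,0,0,0)$; its Hamiltonian is $H=\frac12\langle v,v\rangle-\gamma\frac{q_0}{(1-q_0^2)^{1/2}}$. Set $\boldsymbol\mu=\boldsymbol q\times\boldsymbol v$ and $\boldsymbol\pi=q_0\boldsymbol v-v_0\boldsymbol q$; the quantity $E=H-\frac12|\boldsymbol\mu|^2=\frac12|\boldsymbol\pi|^2-\gamma\frac{q_0}{(1-q_0^2)^{1/2}}$ is conserved. Its Moser regularization, which the paper details for a constant value $E<0$ (where orbits lie in the upper hemisphere), is given by the space $M_E^+=\{\boldsymbol\pi:\boldsymbol\pi\cdot\boldsymbol\pi>2E\}\cup\{\infty\}$ with the Riemannian metric $ds^2=\frac{4\,d\boldsymbol\pi\cdot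 d\boldsymbol\pi}{(\boldsymbol\pi\cdot\boldsymbol\pi-2E)^2}$, whose arc-length parameter $\int ds$ along any circle $t\mapsto\boldsymbol\pi(t)$ associated with a Kepler orbit equals $\int\frac{dt}{q_0|\boldsymbol q|}$, and whose geodesics are precisely the circles or lines $t\mapsto\boldsymbol\pi(t)$ associated with Kepler orbits. Kepler problem in $\mathbb{R}^3$ (time $\tau$): $\frac{d\boldsymbol Q}{d\tau}=\boldsymbol V$, $\frac{d\boldsymbol V}{d\tau}=-\gamma\frac{\boldsymbol Q}{|\boldsymbol Q|^3}$, with Hamiltonian $H_K=\frac12\boldsymbol V\cdot\boldsymbol V-\frac{\gamma}{|\boldsymbol Q|}$. Its Moser regularization for a given constant value $h=H_K$ is given by the space $M_h=\{\boldsymbol V:\boldsymbol V\cdot\boldsymbol V>2h\}\cup\{\infty\}$ with the Riemannian metric $ds^2=\frac{4\,d\boldsymbol V\cdot d\boldsymbol V}{(\boldsymbol V\cdot\boldsymbol V-2h)^2}$, whose arc-length parameter $\int ds$ along any velocity circle $\tau\mapsto\boldsymbol V(\tau)$ equals $\int\frac{d\tau}{|\boldsymbol Q|}$. The gnomonic transformation is the map $\Psi:(q,v)\mapsto(\boldsymbol Q,\boldsymbol V)=\big(\frac{\boldsymbol q}{q_0},\boldsymbol\pi\big)$ on the upper hemisphere, together with the time change $t\mapsto\tau=\int_{t_0}^t\frac{dt}{q_0^2(t)}$ along trajectories, i.e. $d\tau=\frac{dt}{q_0^2}$. *)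

(* Defs.v *)
From Stdlib Require Export Reals Lra.
From Coquelicot Require Export Coquelicot.
Open Scope R_scope.

Definition R3 : Type := (R * R * R)%type.
Definition R4 : Type := (R * R3)%type.

Definition dot (u w : R3) : R :=
  let '(u1, u2, u3) := u in let '(w1, w2, w3) := w in
  u1 * w1 + u2 * w2 + u3 * w3.
Definition cross (u w : R3) : R3 :=
  let '(u1, u2, u3) := u in let '(w1, w2, w3) := w in
  (u2 * w3 - u3 * w2, u3 * w1 - u1 * w3, u1 * w2 - u2 * w1).
Definition norm3 (u : R3) : R := sqrt (dot u u).
Definition inner4 (q v : R4) : R := fst q * fst v + dot (snd q) (snd v).

Definition is_open_interval (I : R -> Prop) : Prop :=
  open I /\ forall x y z : R, I x -> I y -> x <= z <= y -> I z.

(* Phase space over the open upper hemisphere: the collision point e0, where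
   the force is singular, is excluded by the condition q0 < 1. *)
Definition upper_phase (q v : R4) : Prop :=
  inner4 q q = 1 /\ inner4 q v = 0 /\ 0 < fst q < 1.

Definition e0 : R4 := (1, (0, 0, 0)).

Definition force_S3 (gamma : R) (q v : R4) : R4 :=
  let d := sqrt (1 - fst q ^ 2) ^ 3 in
  minus (scal (gamma / d) e0)
        (scal (inner4 v v + gamma * (fst q / d)) q).

Definition hamiltonian_S3 (gamma : R) (q v : R4) : R :=
  / 2 * inner4 v v - gamma * (fst q / sqrt (1 - fst q ^ 2)).
Definition mu (q v : R4) : R3 := cross (snd q) (snd v).
Definition pi3 (q v : R4) : R3 :=
  minus (scal (fst q) (snd v)) (scal (fst v) (snd q)).
Definition energy_S3 (gamma : R) (q v : R4) : R :=
  hamiltonian_S3 gamma q v - / 2 * norm3 (mu q v) ^ 2.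

(* Trajectory in the upper hemisphere, over the time interval I, along which
   the conserved quantity energy_S3 has the value E. *)
Definition kepler_S3 (gamma E : R) (I : R -> Prop) (q v : R -> R4) : Prop :=
  forall t : R, I t ->
    upper_phase (q t) (v t) /\
    is_derive q t (v t) /\
    is_derive v t (force_S3 gamma (q t) (v t)) /\
    energy_S3 gamma (q t) (v t) = E.

Definition hamiltonian_R3 (gamma : R) (Q V : R3) : R :=
  / 2 * dot V V - gamma / norm3 Q.

Definition kepler_R3 (gamma h : R) (J : R -> Prop) (Q V : R -> R3) : Prop :=
  forall tau : R, J tau ->
    Q tau <> (0, 0, 0) /\
    is_derive Q tau (V tau) /\
    is_derive V tau (scal (- gamma / norm3 (Q tau) ^ 3) (Q tau)) /\
    hamiltonian_R3 gamma (Q tau) (V tau) = h.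

Definition Psi (q v : R4) : R3 * R3 := (scal (/ fst q) (snd q), pi3 q v).

Definition new_time (q : R -> R4) (t0 t : R) : R :=
  RInt (fun s => / fst (q s) ^ 2) t0 t.

(* (Q, V), as functions of the new time, are the image of (q, v). *)
Definition gnomonic_image (I : R -> Prop) (q v : R -> R4) (t0 : R)
    (J : R -> Prop) (Q V : R -> R3) : Prop :=
  (forall tau : R, J tau <-> exists t : R, I t /\ tau = new_time q t0 t) /\
  (forall t : R, I t ->
     (Q (new_time q t0 t), V (new_time q t0 t)) = Psi (q t) (v t)).

(* [None] is the point at infinity. *)
Definition M (c : R) (x : option R3) : Prop :=
  match x with Some p => dot p p > 2 * c | None => True end.

Inductive chart : Type := Fin | Inf.

Definition inversion (p : R3) : R3 := scal (/ dot p p) p.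

Definition chart_dom (a : chart) (x : option R3) : Prop :=
  match a with Fin => x <> None | Inf => x <> Some (0, 0, 0) end.

Definition coord (a : chart) (x : option R3) : R3 :=
  match a, x with
  | Fin, Some p => p
  | Inf, Some p => inversion p
  | _, None => (0, 0, 0)
  end.

Definition point (a : chart) (w : R3) : option R3 :=
  match a with
  | Fin => Some w
  | Inf => if Req_EM_T (dot w w) 0 then None else Some (inversion w)
  end.

(* The metric is conformal, ds^2 = factor^2 dw.dw. In the coordinate
   w = p / (p.p) near infinity, 4 dp.dp / (p.p - 2c)^2 becomes
   4 dw.dw / (1 - 2c w.w)^2, which extends smoothly across w = 0. *)
Definition factor (c : R) (a : chart) (w : R3) : R :=
  match a with
  | Fin => 2 / (dot w w - 2 * c)
  | Inf => 2 / (1 - 2 * c * dot w w)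
  end.

Definition metric (c : R) (a : chart) (w u1 u2 : R3) : R :=
  factor c a w ^ 2 * dot u1 u2.

Definition isometry (c c' : R) (Phi : option R3 -> option R3) : Prop :=
  (forall x, M c x -> M c' (Phi x)) /\
  (forall y, M c' y -> exists! x, M c x /\ Phi x = y) /\
  (forall (a b : chart) (x : option R3),
     M c x -> chart_dom a x -> chart_dom b (Phi x) ->
     exists L : R3 -> R3,
       filterdiff (fun w : R3 => coord b (Phi (point a w)))
                  (locally (coord a x)) L /\
       forall u1 u2 : R3,
         metric c' b (coord b (Phi x)) (L u1) (L u2)
         = metric c a (coord a x) u1 u2).

(* Signed length, from time t1 to time t2, of a curve of finite points. *)
Definition arc_length (c : R) (p : R -> R3) (t1 t2 s : R) : Prop :=
  exists p' : R -> R3,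
    (forall t, Rmin t1 t2 <= t <= Rmax t1 t2 -> is_derive p t (p' t)) /\
    is_RInt (fun t => sqrt (metric c Fin (p t) (p' t) (p' t))) t1 t2 s.

Definition gradient (f : R3 -> R) (w : R3) : R3 :=
  let '(x, y, z) := w in
  (Derive (fun r => f (r, y, z)) x,
   Derive (fun r => f (x, r, z)) y,
   Derive (fun r => f (x, y, r)) z).

(* Right-hand side of the geodesic equation w'' = - Gamma(w', w') for the
   metric exp(2f) dw.dw with f = ln factor. *)
Definition geodesic_acceleration (c : R) (a : chart) (w w' : R3) : R3 :=
  let df := gradient (fun z => ln (factor c a z)) w in
  minus (scal (dot w' w') df) (scal (2 * dot df w') w').

(* Unit-speed geodesics, defined on the whole line (these manifolds are
   complete). *)
Definition geodesic (c : R) (sigma : R -> option R3) : Prop :=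
  forall s : R,
    M c (sigma s) /\
    forall a : chart, chart_dom a (sigma s) ->
      let w := fun r => coord a (sigma r) in
      locally s (fun r => chart_dom a (sigma r)) /\
      exists w' : R -> R3,
        locally s (fun r => is_derive w r (w' r)) /\
        is_derive w' s (geodesic_acceleration c a (w s) (w' s)) /\
        metric c a (w s) (w' s) (w' s) = 1.

(* The geodesic sigma of M E, possibly passing through infinity, regularizes
   the orbit (q, v): it is the curve t |-> pi in the parameter
   s = int dt / (q0 |q|). *)
Definition regularizes_S3 (E : R) (I : R -> Prop) (q v : R -> R4) (t0 : R)
    (sigma : R -> option R3) : Prop :=
  geodesic E sigma /\
  forall t : R, I t ->
    sigma (RInt (fun r => / (fst (q r) * norm3 (snd (q r)))) t0 t)
    = Some (pi3 (q t) (v t)).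

Definition regularizes_R3 (h : R) (J : R -> Prop) (Q V : R -> R3) (tau0 : R)
    (sigma : R -> option R3) : Prop :=
  geodesic h sigma /\
  forall tau : R, J tau ->
    sigma (RInt (fun r => / norm3 (Q r)) tau0 tau) = Some (V tau).

(* Main.v *)
Require Import Defs.
From Stdlib Require Import Ranalysis5 ClassicalEpsilon.
Open Scope R_scope.

(** The velocity component of the gnomonic transformation is [pi3] itself, and
    the level [h] of the Euclidean problem that corresponds to the level [E] is
    [E]. The two regularized spaces, with their conformal metrics, are therefore
    one and the same space, and the induced map between them is the identity;
    what remains to be seen is that orbits and parameters correspond.

    Energies. Lagrange's identity gives [pi.pi = <v,v> - |mu|^2] on the tangent
    bundle of the sphere ([dot_pi3]), so [energy_S3] is [pi.pi/2] minus
    [gamma q0/|q|], and [q0/|q| = 1/|Q|]. The inverse of [Psi] comes from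
    [1/q0 = sqrt (1 + Q.Q)].

    Orbits. Differentiating, [d(q/q0)/dt = pi/q0^2] and
    [d pi/dt = - gamma q/|q|^3]: multiplying by [dt/dtau = q0^2] turns these
    into Kepler's equations. For the converse, the same computation is done
    along the inverse of [Psi] with [dt/dtau = 1/(1 + Q.Q)]. In both directions
    the new time has a positive derivative on an open interval, hence a
    differentiable inverse defined on an open interval ([is_derive_inverse]).

    Arc length. On the level [E], [pi.pi - 2E = 2 gamma q0/|q|], while the
    hodograph has Euclidean speed [gamma/|q|^2]; the metric speed is thus
    [1/(q0 |q|)], and likewise [1/|Q|] in the other problem ([speed_S3],
    [speed_R3]). The change of variables [dtau = dt/q0^2] carries
    [dtau/|Q|] to [dt/(q0 |q|)] ([is_RInt_arc_parameters]), so a geodesic that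
    passes through [pi3] at the first parameter passes through [V] at the
    second.

    Isometry. In the finite chart and in the chart at infinity the identity
    reads as the identity or as the inversion [p/(p.p)], a conformal map of
    ratio [1/(p.p)] that exchanges the two conformal factors. *)

(** * Calculus in products and in R3 *)

Ltac coordinates :=
  repeat (progress (unfold minus, plus, opp, scal, mult, zero, one,
    prod_plus, prod_opp, prod_scal; simpl)).

(** Splits an equality of vectors into equalities of coordinates, stated in [R]
    itself rather than in the carrier of a module structure, where [ring] and
    [field] would not recognize it. *)
Ltac componentwise :=
  coordinates; repeat apply (f_equal2 pair);
  match goal with |- ?x = ?y => change (@eq R x y) end.

Local Notation R3_normed :=
  (prod_NormedModule R_AbsRing
    (prod_NormedModule R_AbsRing R_NormedModule R_NormedModule) R_NormedModule).
Local Notation R4_normed := (prod_NormedModule R_AbsRing R_NormedModule R3_normed).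

(** Pairing is the composite with the identity of the product, which is
    linear. *)
Lemma filterdiff_pair {K : AbsRing} {T U V : NormedModule K}
    (F : (T -> Prop) -> Prop) {FF : Filter F}
    (f lf : T -> U) (g lg : T -> V) :
  filterdiff f F lf -> filterdiff g F lg ->
  filterdiff (fun t => (f t, g t)) F (fun t => (lf t, lg t)).
Proof.
intros Hf Hg.
apply (filterdiff_comp_2 f g (fun u v => (u, v) : prod_NormedModule K U V)
         lf lg (fun u v => (u, v))); try assumption.
apply filterdiff_linear, is_linear_prod;
  [apply is_linear_fst | apply is_linear_snd].
Qed.

Lemma filterdiff_fst {K : AbsRing} {T U V : NormedModule K}
    (F : (T -> Prop) -> Prop) {FF : Filter F} (f lf : T -> U * V) :
  filterdiff f F lf -> filterdiff (fun t => fst (f t)) F (fun t => fst (lf t)).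
Proof.
intros Hf; apply (filterdiff_comp f fst lf fst Hf).
apply filterdiff_linear, is_linear_fst.
Qed.

Lemma filterdiff_snd {K : AbsRing} {T U V : NormedModule K}
    (F : (T -> Prop) -> Prop) {FF : Filter F} (f lf : T -> U * V) :
  filterdiff f F lf -> filterdiff (fun t => snd (f t)) F (fun t => snd (lf t)).
Proof.
intros Hf; apply (filterdiff_comp f snd lf snd Hf).
apply filterdiff_linear, is_linear_snd.
Qed.

Lemma is_derive_pair {U V : NormedModule R_AbsRing}
    (f : R -> U) (g : R -> V) (t : R) (l : U) (m : V) :
  is_derive f t l -> is_derive g t m ->
  is_derive (fun s => (f s, g s)) t ((l, m) : U * V).
Proof. intros Hf Hg; exact (filterdiff_pair _ _ _ _ _ Hf Hg). Qed.

Lemma is_derive_fst {U V : NormedModule R_AbsRing}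
    (f : R -> U * V) (t : R) (l : U * V) :
  is_derive f t l -> is_derive (fun s => fst (f s)) t (fst l).
Proof. exact (filterdiff_fst _ f (fun y => scal y l)). Qed.

Lemma is_derive_snd {U V : NormedModule R_AbsRing}
    (f : R -> U * V) (t : R) (l : U * V) :
  is_derive f t l -> is_derive (fun s => snd (f s)) t (snd l).
Proof. exact (filterdiff_snd _ f (fun y => scal y l)). Qed.

Lemma is_derive_scal_fct {V : NormedModule R_AbsRing}
    (f : R -> R) (g : R -> V) (t l : R) (m : V) :
  is_derive f t l -> is_derive g t m ->
  is_derive (fun s => scal (f s) (g s)) t (plus (scal l (g t)) (scal (f t) m)).
Proof.
intros Hf Hg.
refine (filterdiff_ext_lin _ _ _
          (filterdiff_scal_fct t f g _ _ Rmult_comm Hf Hg) _).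
intros y.
rewrite scal_distr_l, !scal_assoc.
apply (f_equal2 plus); [reflexivity|].
apply (f_equal (fun k => scal k m)), Rmult_comm.
Qed.

Lemma filterdiff_mult_fct {U : NormedModule R_AbsRing} (x : U)
    (f g lf lg : U -> R) :
  filterdiff f (locally x) lf -> filterdiff g (locally x) lg ->
  filterdiff (fun u => f u * g u) (locally x)
    (fun u => lf u * g x + f x * lg u).
Proof. intros Hf Hg; exact (filterdiff_scal_fct x f g lf lg Rmult_comm Hf Hg). Qed.

Lemma filterdiff_dot {U : NormedModule R_AbsRing} (x : U)
    (f g lf lg : U -> R3) :
  filterdiff f (locally x) lf -> filterdiff g (locally x) lg ->
  filterdiff (fun u => dot (f u) (g u)) (locally x)
    (fun u => dot (lf u) (g x) + dot (f x) (lg u)).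
Proof.
intros Hf Hg.
pose proof (filterdiff_fst _ _ _ Hf) as Hf'.
pose proof (filterdiff_fst _ _ _ Hg) as Hg'.
pose proof (filterdiff_mult_fct x _ _ _ _
  (filterdiff_fst _ _ _ Hf') (filterdiff_fst _ _ _ Hg')) as H1.
pose proof (filterdiff_mult_fct x _ _ _ _
  (filterdiff_snd _ _ _ Hf') (filterdiff_snd _ _ _ Hg')) as H2.
pose proof (filterdiff_mult_fct x _ _ _ _
  (filterdiff_snd _ _ _ Hf) (filterdiff_snd _ _ _ Hg)) as H3.
pose proof (filterdiff_plus_fct (V := R_NormedModule) _ _ _ _
  (filterdiff_plus_fct (V := R_NormedModule) _ _ _ _ H1 H2) H3) as H.
refine (filterdiff_ext_lin _ _ _ (filterdiff_ext _ _ _ _ H) _).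
- now intros u; destruct (f u) as [[? ?] ?], (g u) as [[? ?] ?].
- intros u; destruct (lf u) as [[? ?] ?], (lg u) as [[? ?] ?],
    (f x) as [[? ?] ?], (g x) as [[? ?] ?].
  coordinates; ring.
Qed.

Lemma is_derive_dot (f g : R -> R3) (t : R) (l m : R3) :
  is_derive f t l -> is_derive g t m ->
  is_derive (fun s => dot (f s) (g s)) t (dot l (g t) + dot (f t) m).
Proof.
intros Hf Hg.
refine (filterdiff_ext_lin _ _ _ (filterdiff_dot t f g _ _ Hf Hg) _).
intros y; destruct l as [[? ?] ?], m as [[? ?] ?], (f t) as [[? ?] ?],
  (g t) as [[? ?] ?]; coordinates; ring.
Qed.

Lemma scal_inv_r {V : NormedModule R_AbsRing} (k : R) (u : V) :
  k <> 0 -> scal k (scal (/ k) u) = u.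
Proof.
intros Hk; rewrite scal_assoc.
replace (mult k (/ k)) with (one : R) by (symmetry; now apply Rinv_r).
apply scal_one.
Qed.

Lemma continuous_of_is_derive {V : NormedModule R_AbsRing}
    (f : R -> V) (t : R) (l : V) : is_derive f t l -> continuous f t.
Proof. intros H; apply ex_derive_continuous; now exists l. Qed.

(** * Change of time *)

Lemma is_open_interval_segment (I : R -> Prop) (a b x : R) :
  is_open_interval I -> I a -> I b -> Rmin a b <= x <= Rmax a b -> I x.
Proof.
intros [_ HI] Ha Hb.
unfold Rmin, Rmax; destruct (Rle_dec a b); intros Hx.
- exact (HI a b x Ha Hb Hx).
- exact (HI b a x Hb Ha Hx).
Qed.

Lemma is_open_interval_neighbours (I : R -> Prop) (t eps : R) :
  is_open_interval I -> I t -> 0 < eps ->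
  exists a b, I a /\ I b /\ t - eps < a < t /\ t < b < t + eps.
Proof.
intros [HI _] Ht Heps.
destruct (HI t Ht) as [d Hd].
pose proof (cond_pos d) as Hd0.
pose proof (Rmin_l d eps); pose proof (Rmin_r d eps).
pose proof (Rmin_glb_lt d eps 0 Hd0 Heps).
exists (t - Rmin d eps / 2), (t + Rmin d eps / 2).
repeat split; try lra; apply Hd.
- change (Rabs (t - Rmin d eps / 2 - t) < d).
  apply Rabs_def1; lra.
- change (Rabs (t + Rmin d eps / 2 - t) < d).
  apply Rabs_def1; lra.
Qed.

Lemma is_derive_RInt_interval (I : R -> Prop) (g : R -> R) (t0 t : R) :
  is_open_interval I -> I t0 -> I t -> (forall s, I s -> continuous g s) ->
  is_derive (fun s => RInt g t0 s) t (g t).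
Proof.
intros HI H0 Ht Hg.
apply is_derive_RInt with t0; [|now apply Hg].
apply (filter_imp I); [|now apply (proj1 HI)].
intros s Hs; apply (RInt_correct g t0 s), ex_RInt_continuous.
intros z Hz; apply Hg, (is_open_interval_segment I t0 s); assumption.
Qed.

Definition image (I : R -> Prop) (F : R -> R) (tau : R) : Prop :=
  exists t, I t /\ tau = F t.

(** A function with positive derivative on an open interval: the form in which
    both changes of time, [t] to [tau] and [tau] to [t], are inverted. *)
Section IncreasingOnInterval.

Variables (I : R -> Prop) (F g : R -> R).
Hypothesis HI : is_open_interval I.
Hypothesis HF : forall t, I t -> is_derive F t (g t).
Hypothesis Hg : forall t, I t -> 0 < g t.

Lemma increasing_on_interval (a b : R) : I a -> I b -> a < b -> F a < F b.
Proof.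
intros Ha Hb Hab.
assert (Hin : forall x, Rmin a b <= x <= Rmax a b -> I x).
{ intros x; now apply is_open_interval_segment. }
destruct (MVT_gen F a b g) as [c [Hc E]].
- intros x Hx; apply HF, Hin; lra.
- intros x Hx; apply continuity_pt_filterlim.
  exact (continuous_of_is_derive _ _ _ (HF x (Hin x Hx))).
- pose proof (Hg c (Hin c Hc)).
  assert (0 < g c * (b - a)) by (apply Rmult_lt_0_compat; lra).
  lra.
Qed.

Lemma increasing_on_interval_reflect (a b : R) :
  I a -> I b -> F a < F b -> a < b.
Proof.
intros Ha Hb H.
destruct (Rtotal_order a b) as [?|[E|E]]; [assumption|subst; lra|].
pose proof (increasing_on_interval b a Hb Ha E); lra.
Qed.

(** Intermediate values. Both the openness and the convexity of the image
    reduce to this. *)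
Lemma image_between (a b y : R) :
  I a -> I b -> F a <= y <= F b -> image I F y.
Proof.
intros Ha Hb Hy.
destruct (Req_dec a b) as [E|E].
{ exists a; split; [assumption|subst; lra]. }
assert (Hab : a < b).
{ destruct (Rtotal_order a b) as [?|[?|E']]; [assumption|contradiction|].
  pose proof (increasing_on_interval b a Hb Ha E'); lra. }
assert (Hin : forall x, a <= x <= b -> I x).
{ intros x; now apply (proj2 HI). }
destruct (f_interv_is_interv F a b y Hab Hy) as [x [Hx Ex]].
- intros x Hx; apply continuity_pt_filterlim.
  exact (continuous_of_is_derive _ _ _ (HF x (Hin x Hx))).
- exists x; split; [now apply Hin|now symmetry].
Qed.

Lemma is_open_interval_image : is_open_interval (image I F).
Proof.
split.
- intros tau [t [Ht ->]].
  destruct (is_open_interval_neighbours I t 1 HI Ht Rlt_0_1)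
    as (a & b & Ha & Hb & Hat & Htb).
  pose proof (increasing_on_interval a t Ha Ht (proj2 Hat)) as H1.
  pose proof (increasing_on_interval t b Ht Hb (proj1 Htb)) as H2.
  apply (locally_interval _ (F t) (F a) (F b) H1 H2).
  intros y Hy1 Hy2; simpl in Hy1, Hy2.
  apply (image_between a b); [assumption..|lra].
- intros x y z [a [Ha ->]] [b [Hb ->]] Hz; now apply (image_between a b).
Qed.

(** A total function, meaningful on the image only: orbits are functions on
    all of [R], restricted by a predicate. *)
Definition inverse (tau : R) : R :=
  epsilon (inhabits 0) (fun t => I t /\ tau = F t).

Lemma inverse_spec (tau : R) :
  image I F tau -> I (inverse tau) /\ F (inverse tau) = tau.
Proof.
intros H.
pose proof (epsilon_spec (inhabits 0) (fun t => I t /\ tau = F t) H) as [H1 H2].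
split; [exact H1 | now symmetry].
Qed.

Lemma inverse_left (t : R) : I t -> inverse (F t) = t.
Proof.
intros Ht.
destruct (inverse_spec (F t)) as [H1 H2]; [now exists t|].
destruct (Rtotal_order (inverse (F t)) t) as [E|[E|E]]; [|assumption|].
- pose proof (increasing_on_interval _ _ H1 Ht E); lra.
- pose proof (increasing_on_interval _ _ Ht H1 E); lra.
Qed.

(** A neighbourhood [(a, b)] of [t] is the preimage under [inverse] of the
    neighbourhood [(F a, F b)] of [F t]. *)
Lemma continuous_inverse (t : R) : I t -> continuous inverse (F t).
Proof.
intros Ht P [eps HP].
unfold filtermap.
rewrite (inverse_left t Ht) in HP.
destruct (is_open_interval_neighbours I t eps HI Ht (cond_pos eps))
  as (a & b & Ha & Hb & Hat & Htb).
pose proof (increasing_on_interval a t Ha Ht (proj2 Hat)) as H1.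
pose proof (increasing_on_interval t b Ht Hb (proj1 Htb)) as H2.
apply (locally_interval _ (F t) (F a) (F b) H1 H2).
intros y Hy1 Hy2; simpl in Hy1, Hy2; apply HP.
destruct (inverse_spec y) as [Hy Ey].
{ apply (image_between a b); [assumption..|lra]. }
assert (a < inverse y).
{ apply increasing_on_interval_reflect; [assumption..|lra]. }
assert (inverse y < b).
{ apply increasing_on_interval_reflect; [assumption..|lra]. }
change (Rabs (inverse y - t) < eps); apply Rabs_def1; lra.
Qed.

(** With [a = inverse y - t] and [b = y - F t], differentiability of [F] says
    that [|b - l a| <= d |a|], as soon as [inverse y] is near [t], which
    continuity of [inverse] ensures. Then [|a| <= 2 |b| / l] when [d <= l / 2],
    so the error [|a - b / l|] is at most [2 d |b| / l^2]. *)
Lemma is_derive_inverse (t : R) : I t -> is_derive inverse (F t) (/ g t).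
Proof.
intros Ht.
pose proof (Hg t Ht) as Hl; set (l := g t) in *.
split; [apply is_linear_scal_l|].
intros x Hx eps.
pose proof (is_filter_lim_locally_unique (V := R_NormedModule) _ _ Hx); subst x.
rewrite (inverse_left t Ht).
(* d <= l / 2 gives the bound on |a|, and 2 d / l^2 <= eps the conclusion. *)
assert (Hd : 0 < Rmin (l / 2) (eps * (l * l / 2))).
{ pose proof (cond_pos eps).
  apply Rmin_glb_lt; [lra|].
  repeat apply Rmult_lt_0_compat; lra. }
set (d := Rmin (l / 2) (eps * (l * l / 2))) in *.
assert (Hd1 : d <= l / 2) by apply Rmin_l.
assert (Hd2 : d <= eps * (l * l / 2)) by apply Rmin_r.
destruct (HF t Ht) as [_ HFt].
specialize (HFt t (fun P H => H) (mkposreal d Hd)); simpl in HFt.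
assert (Hloc : locally (F t) (fun y => norm (minus (minus (F (inverse y)) (F t))
   (scal (minus (inverse y) t) l)) <= d * norm (minus (inverse y) t))).
{ pose proof (continuous_inverse t Ht) as C.
  unfold continuous in C; rewrite (inverse_left t Ht) in C.
  exact (C _ HFt). }
apply (filter_imp (fun y => norm (minus (minus (F (inverse y)) (F t))
   (scal (minus (inverse y) t) l)) <= d * norm (minus (inverse y) t)
   /\ image I F y)).
2: { apply filter_and; [exact Hloc|].
     apply (proj1 is_open_interval_image); now exists t. }
intros y [Hy Iy].
rewrite (proj2 (inverse_spec y Iy)) in Hy.
set (s := inverse y) in *.
change (Rabs (y - F t - (s - t) * l) <= d * Rabs (s - t)) in Hy.
change (Rabs (s - t - (y - F t) * / l) <= eps * Rabs (y - F t)).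
set (a := s - t) in *; set (b := y - F t) in *.
assert (Ha : Rabs a * l <= 2 * Rabs b).
{ assert (Rabs a * l = Rabs (a * l)).
  { rewrite Rabs_mult, (Rabs_pos_eq l); lra. }
  pose proof (Rabs_triang (a * l - b) b) as T.
  replace (a * l - b + b) with (a * l) in T by ring.
  rewrite Rabs_minus_sym in Hy.
  pose proof (Rmult_le_compat_r (Rabs a) _ _ (Rabs_pos a) Hd1).
  lra. }
replace (a - b * / l) with (- ((b - a * l) * / l)) by (field; lra).
rewrite Rabs_Ropp, Rabs_mult, (Rabs_pos_eq (/ l)).
2: { left; now apply Rinv_0_lt_compat. }
apply Rmult_le_reg_r with l; [assumption|].
rewrite Rmult_assoc, Rinv_l, Rmult_1_r by lra.
apply Rle_trans with (1 := Hy).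
apply Rle_trans with (eps * (l * l / 2) * Rabs a).
{ apply Rmult_le_compat_r; [apply Rabs_pos|assumption]. }
replace (eps * (l * l / 2) * Rabs a) with (eps * l / 2 * (Rabs a * l)) by field.
replace (eps * Rabs b * l) with (eps * l / 2 * (2 * Rabs b)) by field.
apply Rmult_le_compat_l; [|assumption].
pose proof (cond_pos eps).
assert (0 < eps * l) by (apply Rmult_lt_0_compat; assumption).
lra.
Qed.

End IncreasingOnInterval.

(** * Norms and inner products in R3 *)

Lemma dot_scal_l (k : R) (u w : R3) : dot (scal k u) w = k * dot u w.
Proof. destruct u as [[? ?] ?], w as [[? ?] ?]; coordinates; ring. Qed.

Lemma dot_scal_r (k : R) (u w : R3) : dot u (scal k w) = k * dot u w.
Proof. destruct u as [[? ?] ?], w as [[? ?] ?]; coordinates; ring. Qed.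

Lemma dot_comm (u w : R3) : dot u w = dot w u.
Proof. destruct u as [[? ?] ?], w as [[? ?] ?]; simpl; ring. Qed.

Lemma dot_nonneg (u : R3) : 0 <= dot u u.
Proof. destruct u as [[x y] z]; simpl; nra. Qed.

Lemma R3_eq_0_of_dot (u : R3) : dot u u = 0 -> u = (0, 0, 0).
Proof.
intros H; destruct u as [[x y] z]; simpl in H; repeat f_equal; nra.
Qed.

Lemma dot_pos (u : R3) : u <> (0, 0, 0) -> 0 < dot u u.
Proof.
intros Hu; destruct (dot_nonneg u) as [H|H]; [exact H|].
exfalso; apply Hu, R3_eq_0_of_dot; now symmetry.
Qed.

Lemma norm3_sqr (u : R3) : norm3 u ^ 2 = dot u u.
Proof. apply pow2_sqrt, dot_nonneg. Qed.

Lemma norm3_pos (u : R3) : u <> (0, 0, 0) -> 0 < norm3 u.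
Proof. intros Hu; apply sqrt_lt_R0, dot_pos, Hu. Qed.

Lemma norm3_scal (k : R) (u : R3) : 0 <= k -> norm3 (scal k u) = k * norm3 u.
Proof.
intros Hk; unfold norm3; rewrite dot_scal_l, dot_scal_r, <- Rmult_assoc.
rewrite sqrt_mult by (try apply dot_nonneg; nra).
now rewrite sqrt_square.
Qed.

Lemma R3_neq_0_of_dot (u : R3) : 0 < dot u u -> u <> (0, 0, 0).
Proof. intros H ->; simpl in H; lra. Qed.

Lemma is_derive_dot_self (f : R -> R3) (t : R) (l : R3) :
  is_derive f t l -> is_derive (fun s => dot (f s) (f s)) t (2 * dot (f t) l).
Proof.
intros H; pose proof (is_derive_dot f f t l l H H) as D.
now replace (2 * dot (f t) l) with (dot l (f t) + dot (f t) l)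
  by (rewrite (dot_comm l); ring).
Qed.

Lemma continuous_inv_norm3 (f : R -> R3) (t : R) (l : R3) :
  is_derive f t l -> f t <> (0, 0, 0) -> continuous (fun s => / norm3 (f s)) t.
Proof.
intros H H0; refine (continuous_of_is_derive (V := R_NormedModule) _ t _ _).
apply is_derive_inv; [|apply Rgt_not_eq, norm3_pos, H0].
apply is_derive_sqrt; [exact (is_derive_dot_self f t l H)|apply dot_pos, H0].
Qed.

(** * The gnomonic map and its inverse *)

Lemma upper_phase_dot (q v : R4) :
  upper_phase q v -> dot (snd q) (snd q) = 1 - fst q ^ 2.
Proof. intros (H & _ & _); unfold inner4 in H; lra. Qed.

Lemma upper_phase_space (q v : R4) : upper_phase q v -> snd q <> (0, 0, 0).
Proof.
intros Hq; apply R3_neq_0_of_dot; rewrite (upper_phase_dot q v Hq).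
destruct Hq as (_ & _ & ?); nra.
Qed.

Lemma upper_phase_norm3 (q v : R4) :
  upper_phase q v -> sqrt (1 - fst q ^ 2) = norm3 (snd q).
Proof. intros Hq; unfold norm3; now rewrite (upper_phase_dot q v Hq). Qed.

(** On tangent vectors of the sphere, the six components of [mu] and [pi3] are
    those of the bivector of [q] and [v], whose squared norm is [<v,v>]. *)
Lemma dot_pi3 (q v : R4) :
  inner4 q q = 1 -> inner4 q v = 0 ->
  dot (pi3 q v) (pi3 q v) = inner4 v v - norm3 (mu q v) ^ 2.
Proof.
rewrite norm3_sqr.
destruct q as [q0 [[q1 q2] q3]], v as [v0 [[v1 v2] v3]].
unfold inner4, pi3, mu; coordinates; intros H1 H2.
(* Lagrange's identity, with |q|^2 = 1 - q0^2 and q.v = - q0 v0. *)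
assert (E1 : q1 * q1 + q2 * q2 + q3 * q3 = 1 - q0 * q0) by lra.
assert (E2 : q1 * v1 + q2 * v2 + q3 * v3 = - (q0 * v0)) by lra.
transitivity (v0 * v0 + (v1 * v1 + v2 * v2 + v3 * v3) -
  ((q1 * q1 + q2 * q2 + q3 * q3) * (v1 * v1 + v2 * v2 + v3 * v3) -
   (q1 * v1 + q2 * v2 + q3 * v3) * (q1 * v1 + q2 * v2 + q3 * v3))).
2: ring.
rewrite E1, E2.
transitivity (q0 * q0 * (v1 * v1 + v2 * v2 + v3 * v3)
  - 2 * q0 * v0 * (q1 * v1 + q2 * v2 + q3 * v3)
  + v0 * v0 * (q1 * q1 + q2 * q2 + q3 * q3)).
{ ring. }
rewrite E1, E2; ring.
Qed.

Lemma energy_S3_pi3 (gamma : R) (q v : R4) : upper_phase q v ->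
  energy_S3 gamma q v
  = / 2 * dot (pi3 q v) (pi3 q v) - gamma * (fst q / norm3 (snd q)).
Proof.
intros Hq; unfold energy_S3, hamiltonian_S3.
rewrite (upper_phase_norm3 q v Hq).
destruct Hq as (H1 & H2 & _); rewrite (dot_pi3 q v H1 H2); ring.
Qed.

Lemma hamiltonian_Psi (gamma : R) (q v : R4) : upper_phase q v ->
  hamiltonian_R3 gamma (fst (Psi q v)) (snd (Psi q v)) = energy_S3 gamma q v.
Proof.
intros Hq; rewrite (energy_S3_pi3 gamma q v Hq).
pose proof (norm3_pos _ (upper_phase_space q v Hq)).
destruct Hq as (_ & _ & Hq).
unfold hamiltonian_R3, Psi; cbn [fst snd].
rewrite norm3_scal by (left; apply Rinv_0_lt_compat; lra).
field; lra.
Qed.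

Lemma Psi_neq_0 (q v : R4) : upper_phase q v -> fst (Psi q v) <> (0, 0, 0).
Proof.
intros Hq; unfold Psi; cbn [fst].
apply R3_neq_0_of_dot; rewrite dot_scal_l, dot_scal_r.
pose proof (dot_pos _ (upper_phase_space q v Hq)).
assert (0 < / fst q) by (apply Rinv_0_lt_compat; apply Hq).
repeat apply Rmult_lt_0_compat; assumption.
Qed.

(** The factor that takes [(1, Q)] back to the sphere; it equals [1/q0]. *)
Definition height (Q : R3) : R := sqrt (1 + dot Q Q).

(** The velocity is obtained from [V] by two relations valid on the tangent
    bundle: [q.pi = - v0], and [v = (pi + v0 q)/q0] in the space components. *)
Definition Psi_inv (Q V : R3) : R4 * R4 :=
  let r := height Q in
  let k := dot Q V / r in
  ((/ r, scal (/ r) Q), (- k, minus (scal r V) (scal k Q))).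

Lemma height_sqr (Q : R3) : height Q ^ 2 = 1 + dot Q Q.
Proof. apply pow2_sqrt; pose proof (dot_nonneg Q); lra. Qed.

Lemma height_pos (Q : R3) : 0 < height Q.
Proof. apply sqrt_lt_R0; pose proof (dot_nonneg Q); lra. Qed.

Lemma height_Psi (q v : R4) : upper_phase q v -> height (fst (Psi q v)) = / fst q.
Proof.
intros Hq; unfold height, Psi; cbn [fst].
rewrite dot_scal_l, dot_scal_r, (upper_phase_dot q v Hq).
destruct Hq as (_ & _ & Hq).
apply sqrt_lem_1.
- replace (1 + _) with (/ fst q * / fst q) by (field; lra).
  apply Rle_0_sqr.
- left; apply Rinv_0_lt_compat; lra.
- field; lra.
Qed.

Lemma upper_phase_Psi_inv (Q V : R3) : Q <> (0, 0, 0) ->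
  upper_phase (fst (Psi_inv Q V)) (snd (Psi_inv Q V)).
Proof.
intros HQ.
pose proof (height_pos Q) as Hr; pose proof (height_sqr Q) as Er.
pose proof (dot_pos Q HQ) as HN.
unfold upper_phase, Psi_inv, inner4; cbn [fst snd].
set (r := height Q) in *.
split; [|split; [|split]].
- rewrite dot_scal_l, dot_scal_r; replace (dot Q Q) with (r ^ 2 - 1) by lra.
  field; lra.
- replace (dot (scal (/ r) Q) (minus (scal r V) (scal (dot Q V / r) Q)))
    with (dot Q V - dot Q V / r ^ 2 * dot Q Q).
  + replace (dot Q Q) with (r ^ 2 - 1) by lra; field; lra.
  + destruct Q as [[? ?] ?], V as [[? ?] ?]; componentwise; field; lra.
- now apply Rinv_0_lt_compat.
- rewrite <- Rinv_1; apply Rinv_lt_contravar; nra.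
Qed.

Lemma Psi_Psi_inv (Q V : R3) : Psi (fst (Psi_inv Q V)) (snd (Psi_inv Q V)) = (Q, V).
Proof.
pose proof (height_pos Q) as Hr.
unfold Psi, Psi_inv, pi3; cbn [fst snd]; set (r := height Q) in *.
set (k := dot Q V / r).
destruct Q as [[? ?] ?], V as [[? ?] ?]; componentwise; field; lra.
Qed.

Lemma Psi_inv_Psi (q v : R4) : upper_phase q v ->
  Psi_inv (fst (Psi q v)) (snd (Psi q v)) = (q, v).
Proof.
intros Hq; unfold Psi_inv; rewrite (height_Psi q v Hq); unfold Psi; cbn [fst snd].
rewrite dot_scal_l.
assert (E : dot (snd q) (pi3 q v) = - fst v).
{ destruct Hq as (H1 & H2 & _).
  destruct q as [q0 [[q1 q2] q3]], v as [v0 [[v1 v2] v3]].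
  unfold inner4 in H1, H2; simpl in H1, H2; unfold pi3; coordinates.
  transitivity (q0 * (q1 * v1 + q2 * v2 + q3 * v3)
    - v0 * (q1 * q1 + q2 * q2 + q3 * q3)).
  { ring. }
  replace (q1 * v1 + q2 * v2 + q3 * v3) with (- (q0 * v0)) by lra.
  replace (q1 * q1 + q2 * q2 + q3 * q3) with (1 - q0 * q0) by lra.
  ring. }
rewrite E; destruct Hq as (_ & _ & Hq).
destruct q as [q0 [[q1 q2] q3]], v as [v0 [[v1 v2] v3]].
unfold pi3; cbn [fst] in Hq; componentwise; field; lra.
Qed.

(** * Equations of motion under the gnomonic map *)

(** The factor [1/q0^2] is the reason for the choice of the time [tau]. *)
Lemma is_derive_central_projection (q v : R -> R4) (t : R) :
  is_derive q t (v t) -> fst (q t) <> 0 ->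
  is_derive (fun s => scal (/ fst (q s)) (snd (q s)) : R3) t
    (scal (/ fst (q t) ^ 2) (pi3 (q t) (v t))).
Proof.
intros Hq H0.
pose proof (is_derive_scal_fct _ _ _ _ _
  (is_derive_inv _ _ _ (is_derive_fst _ _ _ Hq) H0)
  (is_derive_snd _ _ _ Hq)) as D.
refine (eq_ind _ (is_derive _ t) D _ _).
unfold pi3; destruct (q t) as [q0 [[q1 q2] q3]], (v t) as [v0 [[v1 v2] v3]].
cbn [fst] in H0; componentwise; field; exact H0.
Qed.

(** The part of the acceleration that is normal to the sphere is a multiple of
    [q] and cancels; only the attraction along [e0] contributes. *)
Lemma is_derive_pi3 (gamma : R) (q v : R -> R4) (t : R) :
  upper_phase (q t) (v t) -> is_derive q t (v t) ->
  is_derive v t (force_S3 gamma (q t) (v t)) ->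
  is_derive (fun s => pi3 (q s) (v s)) t
    (scal (- gamma / norm3 (snd (q t)) ^ 3) (snd (q t))).
Proof.
intros Hp Hq Hv.
pose proof (is_derive_minus _ _ _ _ _
  (is_derive_scal_fct _ _ _ _ _ (is_derive_fst _ _ _ Hq) (is_derive_snd _ _ _ Hv))
  (is_derive_scal_fct _ _ _ _ _ (is_derive_fst _ _ _ Hv) (is_derive_snd _ _ _ Hq)))
  as D.
refine (eq_ind _ (is_derive _ t) D _ _).
unfold force_S3; rewrite (upper_phase_norm3 _ _ Hp).
pose proof (norm3_pos _ (upper_phase_space _ _ Hp)) as Hn.
set (n := norm3 (snd (q t))) in *; set (lambda := inner4 (v t) (v t)).
destruct (q t) as [q0 [[q1 q2] q3]], (v t) as [v0 [[v1 v2] v3]].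
componentwise; field; lra.
Qed.

Lemma is_derive_height (Q V : R -> R3) (tau : R) :
  is_derive Q tau (V tau) ->
  is_derive (fun s => height (Q s)) tau (dot (Q tau) (V tau) / height (Q tau)).
Proof.
intros HQ; pose proof (height_pos (Q tau)) as Hr.
pose proof (is_derive_plus _ _ _ _ _ (is_derive_const 1 tau)
  (is_derive_dot_self _ _ _ HQ)) as D.
refine (eq_ind _ (is_derive _ tau) (is_derive_sqrt _ _ _ D _) _ _).
- coordinates; pose proof (dot_nonneg (Q tau)); lra.
- coordinates; change (sqrt (1 + dot (Q tau) (Q tau))) with (height (Q tau)).
  field; lra.
Qed.

Lemma is_derive_Psi_inv_position (Q V : R -> R3) (tau : R) :
  is_derive Q tau (V tau) ->
  is_derive (fun s => fst (Psi_inv (Q s) (V s))) tau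
    (scal (/ height (Q tau) ^ 2) (snd (Psi_inv (Q tau) (V tau)))).
Proof.
intros HQ; pose proof (height_pos (Q tau)) as Hr.
pose proof (is_derive_inv _ _ _ (is_derive_height _ _ _ HQ)
  (Rgt_not_eq _ _ Hr)) as Dr.
pose proof (is_derive_pair _ _ _ _ _ Dr
  (is_derive_scal_fct _ _ _ _ _ Dr HQ)) as D.
refine (eq_ind _ (is_derive _ tau) D _ _).
unfold Psi_inv; cbn [fst snd].
set (r := height (Q tau)) in *; set (S := dot (Q tau) (V tau)).
destruct (Q tau) as [[? ?] ?], (V tau) as [[? ?] ?].
componentwise; field; lra.
Qed.

(** Both sides are combinations of the vectors [e0] and [q], so the vector
    identity reduces to two scalar ones, [Ek] and [Ea], between [r = 1/q0],
    [N = |Q|], [S = Q.V] and [W = V.V], subject to [r^2 = 1 + N^2]. *)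
Lemma is_derive_Psi_inv_velocity (gamma : R) (Q V : R -> R3) (tau : R) :
  Q tau <> (0, 0, 0) -> is_derive Q tau (V tau) ->
  is_derive V tau (scal (- gamma / norm3 (Q tau) ^ 3) (Q tau)) ->
  is_derive (fun s => snd (Psi_inv (Q s) (V s))) tau
    (scal (/ height (Q tau) ^ 2)
      (force_S3 gamma (fst (Psi_inv (Q tau) (V tau)))
                      (snd (Psi_inv (Q tau) (V tau))))).
Proof.
intros H0 HQ HV.
pose proof (height_pos (Q tau)) as Hr; pose proof (height_sqr (Q tau)) as Er.
pose proof (norm3_pos _ H0) as HN; pose proof (norm3_sqr (Q tau)) as EN.
pose proof (is_derive_height _ _ _ HQ) as Dr.
pose proof (is_derive_div _ _ _ _ _ (is_derive_dot _ _ _ _ _ HQ HV) Dr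
  (Rgt_not_eq _ _ Hr)) as Dk.
pose proof (is_derive_pair _ _ _ _ _ (is_derive_opp _ _ _ Dk)
  (is_derive_minus _ _ _ _ _ (is_derive_scal_fct _ _ _ _ _ Dr HV)
    (is_derive_scal_fct _ _ _ _ _ Dk HQ))) as D.
refine (eq_ind _ (is_derive _ tau) D _ _).
unfold force_S3; rewrite (upper_phase_norm3 _ _ (upper_phase_Psi_inv _ (V tau) H0)).
unfold Psi_inv; cbn [fst snd].
rewrite norm3_scal by (left; now apply Rinv_0_lt_compat).
rewrite dot_scal_r.
set (r := height (Q tau)) in *; set (N := norm3 (Q tau)) in *.
assert (Evv : inner4
    (- (dot (Q tau) (V tau) / r), minus (scal r (V tau))
       (scal (dot (Q tau) (V tau) / r) (Q tau)))
    (- (dot (Q tau) (V tau) / r), minus (scal r (V tau))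
       (scal (dot (Q tau) (V tau) / r) (Q tau)))
  = r ^ 2 * dot (V tau) (V tau) - dot (Q tau) (V tau) ^ 2).
{ unfold inner4; cbn [fst snd].
  transitivity ((dot (Q tau) (V tau) / r) ^ 2 * (1 + dot (Q tau) (Q tau))
    + r ^ 2 * dot (V tau) (V tau)
    - 2 * (r * (dot (Q tau) (V tau) / r)) * dot (Q tau) (V tau)).
  - set (k := dot (Q tau) (V tau) / r).
    destruct (Q tau) as [[? ?] ?], (V tau) as [[? ?] ?]; coordinates; ring.
  - rewrite <- Er; field; lra. }
rewrite Evv; clear Evv; rewrite <- EN.
set (S := dot (Q tau) (V tau)) in *; set (W := dot (V tau) (V tau)) in *.
rewrite <- EN in Er.
(* k' is the derivative of k = (Q.V)/r as computed by the quotient rule. *)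
set (k' := ((W + - gamma / N ^ 3 * N ^ 2) * r - S * (S / r)) / r ^ 2).
set (lambda := r ^ 2 * W - S ^ 2 + gamma * (/ r / (/ r * N) ^ 3)).
assert (Ek : k' = / r ^ 2 * (lambda * / r - gamma / (/ r * N) ^ 3)).
{ transitivity (/ r ^ 2 * (W * r - gamma * r / N - S ^ 2 / r)).
  { unfold k'; field; lra. }
  transitivity (/ r ^ 2 * (W * r - S ^ 2 / r - gamma * r * (r ^ 2 - 1) / N ^ 3)).
  { replace (r ^ 2 - 1) with (N ^ 2) by lra; field; lra. }
  unfold lambda; field; lra. }
assert (Ea : r * (- gamma / N ^ 3) - k' = - (/ r ^ 2 * (lambda * / r))).
{ rewrite Ek; field; lra. }
apply (f_equal2 pair).
- rewrite Ek; coordinates; ring.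
- transitivity (scal (r * (- gamma / N ^ 3) - k') (Q tau)).
  + destruct (Q tau) as [[? ?] ?], (V tau) as [[? ?] ?].
    componentwise; ring.
  + rewrite Ea; destruct (Q tau) as [[? ?] ?].
    componentwise; ring.
Qed.
Lemma kepler_S3_time_density (gamma E : R) (I : R -> Prop) (q v : R -> R4) (t : R) :
  kepler_S3 gamma E I q v -> I t ->
  continuous (fun s => / fst (q s) ^ 2) t /\ 0 < / fst (q t) ^ 2.
Proof.
intros HK Ht; destruct (HK t Ht) as ((_ & _ & H0) & Hq & _).
assert (H2 : 0 < fst (q t) ^ 2) by (apply pow_lt; lra).
split; [|now apply Rinv_0_lt_compat].
refine (continuous_of_is_derive (V := R_NormedModule) _ t _ _).
apply is_derive_inv; [|now apply Rgt_not_eq].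
apply is_derive_pow, (is_derive_fst _ _ _ Hq).
Qed.

Lemma is_derive_new_time (gamma E : R) (I : R -> Prop) (q v : R -> R4) (t0 t : R) :
  is_open_interval I -> I t0 -> kepler_S3 gamma E I q v -> I t ->
  is_derive (new_time q t0) t (/ fst (q t) ^ 2).
Proof.
intros HI H0 HK Ht.
apply (is_derive_RInt_interval I (fun s => / fst (q s) ^ 2) t0 t HI H0 Ht).
intros s Hs; exact (proj1 (kepler_S3_time_density _ _ _ _ _ s HK Hs)).
Qed.

Lemma new_time_origin (q : R -> R4) (t0 : R) : new_time q t0 t0 = 0.
Proof. apply (RInt_point (V := R_CompleteNormedModule)). Qed.

(** The orbit is transported by [Psi] and reparametrized by the inverse [G] of
    [new_time]. *)
Lemma kepler_S3_to_R3 (gamma E : R) (I : R -> Prop) (q v : R -> R4) (t0 : R) :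
  is_open_interval I -> I t0 -> kepler_S3 gamma E I q v ->
  exists (J : R -> Prop) (Q V : R -> R3),
    is_open_interval J /\ J 0 /\ kepler_R3 gamma E J Q V /\
    gnomonic_image I q v t0 J Q V.
Proof.
intros HI H0 HK.
set (F := new_time q t0); set (g := fun t => / fst (q t) ^ 2).
assert (HF : forall t, I t -> is_derive F t (g t)).
{ intros t; exact (is_derive_new_time gamma E I q v t0 t HI H0 HK). }
assert (Hg : forall t, I t -> 0 < g t).
{ intros t Ht; exact (proj2 (kepler_S3_time_density _ _ _ _ _ t HK Ht)). }
set (G := inverse I F).
assert (HG : forall t, I t -> G (F t) = t) by exact (inverse_left I F g HI HF Hg).
exists (image I F), (fun tau => fst (Psi (q (G tau)) (v (G tau)))),
  (fun tau => snd (Psi (q (G tau)) (v (G tau)))).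
split; [|split; [|split; [|split]]].
- exact (is_open_interval_image I F g HI HF Hg).
- exists t0; split; [exact H0|symmetry; apply new_time_origin].
- intros tau [t [Ht ->]]; destruct (HK t Ht) as (Hp & Hq & Hv & HE).
  pose proof Hp as (_ & _ & Hq0).
  assert (DG : is_derive G (F t) (fst (q t) ^ 2)).
  { rewrite <- (Rinv_inv (fst (q t) ^ 2)).
    exact (is_derive_inverse I F g HI HF Hg t Ht). }
  rewrite (HG t Ht); split; [|split; [|split]].
  + exact (Psi_neq_0 _ _ Hp).
  + pose proof (is_derive_central_projection q v t Hq
      ltac:(apply Rgt_not_eq, Hq0)) as D.
    rewrite <- (HG t Ht) in D at 1.
    refine (eq_ind _ (is_derive _ (F t)) (is_derive_comp _ _ _ _ _ D DG) _ _).
    apply (scal_inv_r (V := R3_normed)), pow_nonzero; lra.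
  + pose proof (is_derive_pi3 gamma q v t Hp Hq Hv) as D.
    rewrite <- (HG t Ht) in D at 1.
    refine (eq_ind _ (is_derive _ (F t)) (is_derive_comp _ _ _ _ _ D DG) _ _).
    unfold Psi; cbn [fst snd].
    rewrite norm3_scal by (left; apply Rinv_0_lt_compat, Hq0).
    pose proof (norm3_pos _ (upper_phase_space _ _ Hp)).
    rewrite !scal_assoc.
    apply (f_equal (fun k => scal k (snd (q t)))).
    unfold mult; simpl; field; lra.
  + rewrite (hamiltonian_Psi gamma _ _ Hp); exact HE.
- intros tau; split; intros H; exact H.
- intros t Ht; fold F; rewrite (HG t Ht); reflexivity.
Qed.

(** [F] integrates [dt = q0^2 dtau] along the given orbit, and its inverse [G]
    reparametrizes the image of the orbit under [Psi_inv]. *)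
Lemma kepler_R3_to_S3 (gamma E : R) (J : R -> Prop) (Q V : R -> R3) (t0 : R) :
  is_open_interval J -> J 0 -> kepler_R3 gamma E J Q V ->
  exists (I : R -> Prop) (q v : R -> R4),
    is_open_interval I /\ I t0 /\ kepler_S3 gamma E I q v /\
    gnomonic_image I q v t0 J Q V.
Proof.
intros HJ H0 HK.
set (g := fun tau => / height (Q tau) ^ 2).
set (F := fun tau => t0 + RInt g 0 tau).
assert (Hr : forall tau, 0 < height (Q tau) ^ 2).
{ intros tau; apply pow_lt, height_pos. }
assert (Cr : forall tau, J tau -> continuous (fun s => height (Q s) ^ 2) tau).
{ intros tau Htau; destruct (HK tau Htau) as (_ & HQ & _).
  refine (continuous_of_is_derive (V := R_NormedModule) _ tau _ _).
  apply is_derive_pow; exact (is_derive_height _ _ _ HQ). }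
assert (HF : forall tau, J tau -> is_derive F tau (g tau)).
{ intros tau Htau.
  assert (D : is_derive (fun s => RInt g 0 s) tau (g tau)).
  { apply (is_derive_RInt_interval J); [assumption..|].
    intros s Hs; apply continuous_Rinv_comp; [now apply Cr|].
    apply Rgt_not_eq, Hr. }
  refine (eq_ind _ (is_derive _ tau)
    (is_derive_plus _ _ _ _ _ (is_derive_const t0 tau) D) _ _).
  apply Rplus_0_l. }
assert (Hg : forall tau, J tau -> 0 < g tau).
{ intros tau _; apply Rinv_0_lt_compat, Hr. }
set (G := inverse J F).
assert (HG : forall tau, J tau -> G (F tau) = tau)
  by exact (inverse_left J F g HJ HF Hg).
assert (F0 : F 0 = t0).
{ unfold F; rewrite (RInt_point (V := R_CompleteNormedModule)).
  apply Rplus_0_r. }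
set (q := fun t => fst (Psi_inv (Q (G t)) (V (G t)))).
set (v := fun t => snd (Psi_inv (Q (G t)) (V (G t)))).
assert (DG : forall tau, J tau -> is_derive G (F tau) (height (Q tau) ^ 2)).
{ intros tau Htau; rewrite <- (Rinv_inv (height (Q tau) ^ 2)).
  exact (is_derive_inverse J F g HJ HF Hg tau Htau). }
assert (HI : is_open_interval (image J F))
  by exact (is_open_interval_image J F g HJ HF Hg).
assert (It0 : image J F t0) by (exists 0; split; [exact H0|now rewrite F0]).
(* The time change of q undoes the one used to define q: the integrand
   1/q0^2 is the derivative of G. *)
assert (HT : forall t, image J F t -> new_time q t0 t = G t).
{ intros t Ht; unfold new_time.
  assert (Hin : forall s, Rmin t0 t <= s <= Rmax t0 t ->
    is_derive G s (height (Q (G s)) ^ 2) /\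
    continuous (fun s => height (Q (G s)) ^ 2) s).
  { intros s Hs.
    destruct (is_open_interval_segment _ t0 t s HI It0 Ht Hs) as [tau [Htau ->]].
    split.
    - rewrite (HG tau Htau); now apply DG.
    - apply (continuous_comp G (fun s => height (Q s) ^ 2)).
      + exact (continuous_of_is_derive _ _ _ (DG tau Htau)).
      + rewrite (HG tau Htau); now apply Cr. }
  rewrite (RInt_ext _ (fun s => height (Q (G s)) ^ 2)).
  2: { intros s _; unfold q, Psi_inv; cbn [fst].
       now rewrite pow_inv, Rinv_inv. }
  rewrite (is_RInt_unique _ _ _ _ (is_RInt_derive G _ t0 t
    (fun s Hs => proj1 (Hin s Hs)) (fun s Hs => proj2 (Hin s Hs)))).
  replace (G t0) with 0 by (rewrite <- F0; symmetry; now apply HG).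
  apply Rminus_0_r. }
exists (image J F), q, v.
split; [exact HI|split; [exact It0|split; [|split]]].
- intros t [tau [Htau ->]]; destruct (HK tau Htau) as (HQ0 & HQ & HV & HE).
  pose proof (upper_phase_Psi_inv (Q tau) (V tau) HQ0) as Hp.
  assert (Hq : q (F tau) = fst (Psi_inv (Q tau) (V tau)))
    by (unfold q; now rewrite (HG tau Htau)).
  assert (Hv : v (F tau) = snd (Psi_inv (Q tau) (V tau)))
    by (unfold v; now rewrite (HG tau Htau)).
  rewrite Hq, Hv; split; [exact Hp|split; [|split]].
  + pose proof (is_derive_Psi_inv_position Q V tau HQ) as D.
    rewrite <- (HG tau Htau) in D at 1.
    refine (eq_ind _ (is_derive _ (F tau))
      (is_derive_comp _ _ _ _ _ D (DG tau Htau)) _ _).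
    apply (scal_inv_r (V := R4_normed)), Rgt_not_eq, Hr.
  + pose proof (is_derive_Psi_inv_velocity gamma Q V tau HQ0 HQ HV) as D.
    rewrite <- (HG tau Htau) in D at 1.
    refine (eq_ind _ (is_derive _ (F tau))
      (is_derive_comp _ _ _ _ _ D (DG tau Htau)) _ _).
    apply (scal_inv_r (V := R4_normed)), Rgt_not_eq, Hr.
  + rewrite <- (hamiltonian_Psi gamma _ _ Hp), Psi_Psi_inv; exact HE.
- intros tau; split.
  + intros Htau; exists (F tau).
    assert (It : image J F (F tau)) by now exists tau.
    split; [exact It|].
    now rewrite (HT _ It), (HG tau Htau).
  + intros (t & It & ->); rewrite (HT t It).
    destruct It as [tau [Htau ->]]; now rewrite (HG tau Htau).
- intros t It; rewrite (HT t It).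
  symmetry; apply Psi_Psi_inv.
Qed.

(** * Arc length *)

Lemma speed_S3 (gamma E : R) (q v : R4) : 0 < gamma ->
  upper_phase q v -> energy_S3 gamma q v = E ->
  let p' := scal (- gamma / norm3 (snd q) ^ 3) (snd q) in
  sqrt (metric E Fin (pi3 q v) p' p') = / (fst q * norm3 (snd q)).
Proof.
intros Hgamma Hp HE p'.
rewrite (energy_S3_pi3 gamma q v Hp) in HE.
pose proof (norm3_pos _ (upper_phase_space _ _ Hp)) as Hn.
destruct Hp as (_ & _ & H0 & _).
assert (0 < fst q * norm3 (snd q)) by (apply Rmult_lt_0_compat; assumption).
replace (metric E Fin (pi3 q v) p' p') with ((/ (fst q * norm3 (snd q))) ^ 2).
- apply sqrt_pow2; left; now apply Rinv_0_lt_compat.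
- unfold metric, p', factor; rewrite dot_scal_l, dot_scal_r, <- (norm3_sqr (snd q)).
  replace (dot (pi3 q v) (pi3 q v) - 2 * E)
    with (2 * gamma * (fst q / norm3 (snd q))) by lra.
  field; lra.
Qed.

Lemma speed_R3 (gamma h : R) (Q V : R3) : 0 < gamma ->
  Q <> (0, 0, 0) -> hamiltonian_R3 gamma Q V = h ->
  let V' := scal (- gamma / norm3 Q ^ 3) Q in
  sqrt (metric h Fin V V' V') = / norm3 Q.
Proof.
intros Hgamma HQ Hh V'; unfold hamiltonian_R3 in Hh.
pose proof (norm3_pos _ HQ) as HN.
replace (metric h Fin V V' V') with ((/ norm3 Q) ^ 2).
- apply sqrt_pow2; left; now apply Rinv_0_lt_compat.
- unfold metric, V', factor; rewrite dot_scal_l, dot_scal_r, <- (norm3_sqr Q).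
  replace (dot V V - 2 * h) with (2 * (gamma / norm3 Q)) by lra.
  field; lra.
Qed.

(** Substitution [tau = new_time q t0 t], with
    [(1/q0^2) (1/|Q|) = 1/(q0 |q|)]. *)
Lemma is_RInt_arc_parameters (gamma E : R) (I : R -> Prop) (q v : R -> R4)
    (t0 : R) (J : R -> Prop) (Q V : R -> R3) (t1 t2 : R) :
  is_open_interval I -> I t0 -> kepler_S3 gamma E I q v ->
  is_open_interval J -> kepler_R3 gamma E J Q V ->
  gnomonic_image I q v t0 J Q V -> I t1 -> I t2 ->
  exists s : R,
    is_RInt (fun t => / (fst (q t) * norm3 (snd (q t)))) t1 t2 s /\
    is_RInt (fun tau => / norm3 (Q tau)) (new_time q t0 t1) (new_time q t0 t2) s.
Proof.
intros HI H0 HK HJ HK' [HT HPsi] H1 H2.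
set (f := fun tau => / norm3 (Q tau)).
exists (RInt f (new_time q t0 t1) (new_time q t0 t2)).
assert (Cf : forall tau, J tau -> continuous f tau).
{ intros tau Htau; destruct (HK' tau Htau) as (HQ0 & HQ & _).
  exact (continuous_inv_norm3 Q tau _ HQ HQ0). }
assert (Hin : forall t, Rmin t1 t2 <= t <= Rmax t1 t2 -> I t).
{ intros t; now apply is_open_interval_segment. }
assert (HJT : forall t, I t -> J (new_time q t0 t)).
{ intros t Ht; apply HT; now exists t. }
split.
- apply is_RInt_ext with
    (f := fun t => scal (/ fst (q t) ^ 2) (f (new_time q t0 t))).
  + intros t Ht; assert (It : I t) by (apply Hin; lra).
    destruct (HK t It) as (Hp & _).
    pose proof (norm3_pos _ (upper_phase_space _ _ Hp)).
    destruct Hp as (_ & _ & Hq0).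
    unfold f; rewrite (f_equal fst (HPsi t It) : Q _ = _); unfold Psi; cbn [fst].
    rewrite norm3_scal by (left; apply Rinv_0_lt_compat, Hq0).
    unfold scal; simpl; unfold mult; simpl; field; lra.
  + apply (is_RInt_comp f (new_time q t0)).
    * intros t Ht; now apply Cf, HJT, Hin.
    * intros t Ht; specialize (Hin t Ht); split.
      -- now apply (is_derive_new_time gamma E I q v).
      -- exact (proj1 (kepler_S3_time_density _ _ _ _ _ t HK Hin)).
- apply (RInt_correct f), ex_RInt_continuous; intros tau Htau.
  apply Cf, (is_open_interval_segment J _ _ tau HJ (HJT t1 H1) (HJT t2 H2) Htau).
Qed.

Lemma arc_length_pi3 (gamma E : R) (I : R -> Prop) (q v : R -> R4) (t1 t2 s : R) :
  0 < gamma -> is_open_interval I -> kepler_S3 gamma E I q v -> I t1 -> I t2 ->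
  is_RInt (fun t => / (fst (q t) * norm3 (snd (q t)))) t1 t2 s ->
  arc_length E (fun t => pi3 (q t) (v t)) t1 t2 s.
Proof.
intros Hgamma HI HK H1 H2 Hs.
assert (Hin : forall t, Rmin t1 t2 <= t <= Rmax t1 t2 -> I t).
{ intros t; now apply is_open_interval_segment. }
exists (fun t => scal (- gamma / norm3 (snd (q t)) ^ 3) (snd (q t))); split.
- intros t Ht; destruct (HK t (Hin t Ht)) as (Hp & Hq & Hv & _).
  now apply is_derive_pi3.
- refine (is_RInt_ext _ _ _ _ _ _ Hs); intros t Ht.
  destruct (HK t) as (Hp & _ & _ & HE); [apply Hin; lra|].
  symmetry; exact (speed_S3 gamma E _ _ Hgamma Hp HE).
Qed.

Lemma arc_length_velocity (gamma h : R) (J : R -> Prop) (Q V : R -> R3)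
    (tau1 tau2 s : R) :
  0 < gamma -> is_open_interval J -> kepler_R3 gamma h J Q V -> J tau1 -> J tau2 ->
  is_RInt (fun tau => / norm3 (Q tau)) tau1 tau2 s ->
  arc_length h V tau1 tau2 s.
Proof.
intros Hgamma HJ HK H1 H2 Hs.
assert (Hin : forall t, Rmin tau1 tau2 <= t <= Rmax tau1 tau2 -> J t).
{ intros t; now apply is_open_interval_segment. }
exists (fun tau => scal (- gamma / norm3 (Q tau) ^ 3) (Q tau)); split.
- intros t Ht; now apply (HK t (Hin t Ht)).
- refine (is_RInt_ext _ _ _ _ _ _ Hs); intros t Ht.
  destruct (HK t) as (HQ & _ & _ & HE); [apply Hin; lra|].
  symmetry; exact (speed_R3 gamma h _ _ Hgamma HQ HE).
Qed.

(** * Inversion and the two charts *)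

Definition inversion_differential (p u : R3) : R3 :=
  minus (scal (/ dot p p) u) (scal (2 * dot p u / dot p p ^ 2) p).

Lemma filterdiff_inversion (p : R3) : 0 < dot p p ->
  filterdiff inversion (locally p) (inversion_differential p).
Proof.
intros Hp.
pose proof (filterdiff_id (K := R_AbsRing) (V := R3_normed) (locally p)) as Hid.
pose proof (filterdiff_dot p _ _ _ _ Hid Hid) as Hd.
pose proof (is_derive_inv (fun y => y) (dot p p) one (is_derive_id (dot p p))
  (Rgt_not_eq _ _ Hp)) as Hinv.
pose proof (filterdiff_scal_fct p _ _ _ _ Rmult_comm
  (filterdiff_comp' _ _ p _ _ Hd Hinv) Hid) as D.
refine (filterdiff_ext_lin _ _ _ D _).
intros u; unfold inversion_differential; rewrite (dot_comm u p).
set (k := dot p p) in *; set (S := dot p u).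
destruct p as [[? ?] ?], u as [[? ?] ?]; componentwise; field; lra.
Qed.

(** The differential of the inversion is [1/(p.p)] times the reflection in the
    plane orthogonal to [p]: the inversion is conformal. *)
Lemma dot_inversion_differential (p u1 u2 : R3) : 0 < dot p p ->
  dot (inversion_differential p u1) (inversion_differential p u2)
  = dot u1 u2 / dot p p ^ 2.
Proof.
intros Hp; unfold inversion_differential.
transitivity (dot u1 u2 / dot p p ^ 2
  - 2 * (2 * dot p u1 * dot p u2) / dot p p ^ 3
  + 4 * dot p u1 * dot p u2 / dot p p ^ 4 * dot p p).
2: field; lra.
set (a := 2 * dot p u1 / dot p p ^ 2); set (b := 2 * dot p u2 / dot p p ^ 2).
transitivity (/ dot p p * / dot p p * dot u1 u2
  - / dot p p * b * dot p u1 - a * / dot p p * dot p u2 + a * b * dot p p).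
- set (k := / dot p p).
  destruct p as [[? ?] ?], u1 as [[? ?] ?], u2 as [[? ?] ?]; coordinates; ring.
- unfold a, b; field; lra.
Qed.

Lemma dot_inversion (p : R3) : dot (inversion p) (inversion p) = / dot p p.
Proof.
unfold inversion; rewrite dot_scal_l, dot_scal_r.
destruct (Req_dec (dot p p) 0) as [E|E]; [rewrite E, Rinv_0; ring|field; exact E].
Qed.

Lemma inversion_0 : inversion (0, 0, 0) = (0, 0, 0).
Proof. unfold inversion; componentwise; ring. Qed.

Lemma inversion_involutive (p : R3) : inversion (inversion p) = p.
Proof.
destruct (Req_dec (dot p p) 0) as [E|E].
- now rewrite (R3_eq_0_of_dot p E), !inversion_0.
- unfold inversion at 1; rewrite dot_inversion, Rinv_inv; unfold inversion.
  destruct p as [[x y] z]; set (k := dot _ _) in *.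
  componentwise; field; exact E.
Qed.

(** The changes of chart, extended to the centre of the inversion: there
    [/ 0 = 0] makes [inversion] agree with the value [(0, 0, 0)] that [coord]
    gives at infinity, so no case is lost. *)
Definition transition (a b : chart) (w : R3) : R3 :=
  match a, b with
  | Fin, Fin | Inf, Inf => w
  | _, _ => inversion w
  end.

Lemma coord_point (a b : chart) (w : R3) : coord b (point a w) = transition a b w.
Proof.
destruct a, b; simpl; try reflexivity;
  destruct (Req_EM_T (dot w w) 0) as [E|E]; simpl.
- now rewrite (R3_eq_0_of_dot w E), inversion_0.
- reflexivity.
- now rewrite (R3_eq_0_of_dot w E).
- apply inversion_involutive.
Qed.

(** Not trivial, as an isometry is tested in every pair of charts: when they
    differ, the identity is read as the inversion, and the claim is that the
    two expressions of the metric define the same metric. *)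
Lemma isometry_id (c : R) : isometry c c (fun x => x).
Proof.
split; [|split].
- intros x Hx; exact Hx.
- intros y Hy; exists y; split; [now split|].
  intros x [_ Hx]; now symmetry.
- assert (Hinv : forall (a b : chart) (w : R3), 0 < dot w w ->
    factor c b (inversion w) ^ 2 / dot w w ^ 2 = factor c a w ^ 2 ->
    (forall w', coord b (point a w') = inversion w') ->
    exists L : R3 -> R3,
      filterdiff (fun w => coord b (point a w)) (locally w) L /\
      forall u1 u2, metric c b (inversion w) (L u1) (L u2) = metric c a w u1 u2).
  { intros a b w Hw Hf Hext; exists (inversion_differential w); split.
    - apply (filterdiff_ext inversion).
      + intros w'; symmetry; apply Hext.
      + now apply filterdiff_inversion.
    - intros u1 u2; unfold metric.
      rewrite (dot_inversion_differential w u1 u2 Hw), <- Hf.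
      field; lra. }
  assert (Hid : forall (a : chart) (x : option R3),
    exists L : R3 -> R3,
      filterdiff (fun w => coord a (point a w)) (locally (coord a x)) L /\
      forall u1 u2, metric c a (coord a x) (L u1) (L u2)
        = metric c a (coord a x) u1 u2).
  { intros a x; exists (fun u => u); split; [|reflexivity].
    apply (filterdiff_ext (fun w => w)).
    - intros w; rewrite coord_point; now destruct a.
    - apply filterdiff_id. }
  intros a b x Hx Ha Hb.
  destruct a, b; try apply Hid; destruct x as [p|]; try (now destruct Ha);
    try (now destruct Hb); cbn [M chart_dom coord] in Hx, Ha, Hb |- *.
  + assert (Hp : 0 < dot p p) by (apply dot_pos; intros ->; now apply Hb).
    apply (Hinv Fin Inf p Hp).
    * unfold factor; rewrite dot_inversion; field; split; nra.
    * intros w; apply (coord_point Fin Inf).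
  + assert (Hp : 0 < dot p p) by (apply dot_pos; intros ->; now apply Ha).
    assert (Hw : 0 < dot (inversion p) (inversion p)).
    { rewrite dot_inversion; now apply Rinv_0_lt_compat. }
    pose proof (Hinv Inf Fin (inversion p) Hw) as H.
    rewrite inversion_involutive in H; apply H.
    * unfold factor; rewrite dot_inversion.
      field; split; nra.
    * intros w; apply (coord_point Inf Fin).
Qed.

(** * The gnomonic transformation and the regularizations *)

(** At corresponding times the two arc-length parameters take the same value,
    and so do the two hodographs. *)
Lemma regularizes_gnomonic (gamma E : R) (I : R -> Prop) (q v : R -> R4) (t0 : R)
    (J : R -> Prop) (Q V : R -> R3) (sigma : R -> option R3) :
  is_open_interval I -> I t0 -> kepler_S3 gamma E I q v ->
  is_open_interval J -> kepler_R3 gamma E J Q V ->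
  gnomonic_image I q v t0 J Q V ->
  (regularizes_S3 E I q v t0 sigma <-> regularizes_R3 E J Q V 0 sigma).
Proof.
intros HI H0 HK HJ HK' Hgn.
assert (Es : forall t, I t ->
  RInt (fun r => / norm3 (Q r)) 0 (new_time q t0 t)
  = RInt (fun r => / (fst (q r) * norm3 (snd (q r)))) t0 t).
{ intros t Ht.
  destruct (is_RInt_arc_parameters gamma E I q v t0 J Q V t0 t)
    as (s & Hs & Hs'); try assumption.
  rewrite new_time_origin in Hs'.
  now rewrite (is_RInt_unique _ _ _ _ Hs), (is_RInt_unique _ _ _ _ Hs'). }
destruct Hgn as [HT HPsi].
split; intros [Hgeo Hsigma]; split; try exact Hgeo.
- intros tau Htau; apply HT in Htau as (t & Ht & ->).
  rewrite (Es t Ht), (Hsigma t Ht).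
  now rewrite (f_equal snd (HPsi t Ht) : V _ = _).
- intros t Ht.
  rewrite <- (Es t Ht), (Hsigma (new_time q t0 t)) by (apply HT; now exists t).
  now rewrite (f_equal snd (HPsi t Ht) : V _ = _).
Qed.

Theorem proposition6p7 (gamma E : R) (hgamma : 0 < gamma) :
  (* Psi maps the level E of the S^3 problem bijectively onto the level
     h = E of the R^3 problem *)
  (forall q v : R4, upper_phase q v ->
     fst (Psi q v) <> (0, 0, 0) /\
     hamiltonian_R3 gamma (fst (Psi q v)) (snd (Psi q v))
     = energy_S3 gamma q v) /\
  (forall Q V : R3, Q <> (0, 0, 0) ->
     exists! qv : R4 * R4,
       upper_phase (fst qv) (snd qv) /\ Psi (fst qv) (snd qv) = (Q, V)) /\
  (* with the time change, it maps orbits to orbits, in both directions *)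
  (forall (I : R -> Prop) (q v : R -> R4) (t0 : R),
     is_open_interval I -> I t0 -> kepler_S3 gamma E I q v ->
     exists (J : R -> Prop) (Q V : R -> R3),
       is_open_interval J /\ J 0 /\ kepler_R3 gamma E J Q V /\
       gnomonic_image I q v t0 J Q V) /\
  (forall (J : R -> Prop) (Q V : R -> R3) (t0 : R),
     is_open_interval J -> J 0 -> kepler_R3 gamma E J Q V ->
     exists (I : R -> Prop) (q v : R -> R4),
       is_open_interval I /\ I t0 /\ kepler_S3 gamma E I q v /\
       gnomonic_image I q v t0 J Q V) /\
  (* the arc-length parameters of the two regularizations agree *)
  (forall (I : R -> Prop) (q v : R -> R4) (t0 : R)
          (J : R -> Prop) (Q V : R -> R3) (t1 t2 : R),
     is_open_interval I -> I t0 -> kepler_S3 gamma E I q v ->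
     is_open_interval J -> kepler_R3 gamma E J Q V ->
     gnomonic_image I q v t0 J Q V -> I t1 -> I t2 ->
     exists s : R,
       arc_length E (fun t => pi3 (q t) (v t)) t1 t2 s /\
       is_RInt (fun t => / (fst (q t) * norm3 (snd (q t)))) t1 t2 s /\
       is_RInt (fun tau => / norm3 (Q tau))
               (new_time q t0 t1) (new_time q t0 t2) s /\
       arc_length E V (new_time q t0 t1) (new_time q t0 t2) s) /\
  (* Psi induces an isometry of the regularized spaces, which carries the
     regularized orbits to the regularized orbits *)
  (exists Phi : option R3 -> option R3,
     Phi None = None /\
     (forall q v : R4, upper_phase q v -> energy_S3 gamma q v = E ->
        Phi (Some (pi3 q v)) = Some (snd (Psi q v))) /\
     isometry E E Phi /\
     (forall sigma : R -> option R3, (forall s : R, M E (sigma s)) ->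
        (geodesic E sigma <-> geodesic E (fun s => Phi (sigma s)))) /\
     (forall (I : R -> Prop) (q v : R -> R4) (t0 : R)
             (J : R -> Prop) (Q V : R -> R3) (sigma : R -> option R3),
        is_open_interval I -> I t0 -> kepler_S3 gamma E I q v ->
        is_open_interval J -> kepler_R3 gamma E J Q V ->
        gnomonic_image I q v t0 J Q V -> (forall s : R, M E (sigma s)) ->
        (regularizes_S3 E I q v t0 sigma <->
         regularizes_R3 E J Q V 0 (fun s => Phi (sigma s))))).

Proof.
split; [|split; [|split; [|split; [|split]]]].
- intros q v Hq; split; [now apply Psi_neq_0|now apply hamiltonian_Psi].
- intros Q V HQ; exists (Psi_inv Q V); split.
  + split; [now apply upper_phase_Psi_inv|apply Psi_Psi_inv].
  + intros [q v]; cbn [fst snd]; intros [Hq HPsi].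
    rewrite <- (Psi_inv_Psi q v Hq), HPsi; reflexivity.
- intros I q v t0; apply kepler_S3_to_R3.
- intros J Q V t0; apply kepler_R3_to_S3.
- intros I q v t0 J Q V t1 t2 HI H0 HK HJ HK' Hgn H1 H2.
  destruct (is_RInt_arc_parameters gamma E I q v t0 J Q V t1 t2)
    as (s & Hs & Hs'); try assumption.
  exists s; split; [|split; [exact Hs|split; [exact Hs'|]]].
  + now apply (arc_length_pi3 gamma E I).
  + apply (arc_length_velocity gamma E J Q); try assumption;
      apply (proj1 Hgn); [now exists t1|now exists t2].
(* pi3 is the second component of Psi, so the induced map is the identity. *)
- exists (fun x => x).
  split; [reflexivity|split; [reflexivity|split; [apply isometry_id|split]]].
  + intros sigma _; reflexivity.
  + intros I q v t0 J Q V sigma HI H0 HK HJ HK' Hgn _.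
    now apply (regularizes_gnomonic gamma).
Qed.
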